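(* Let $x$ be an indeterminate. For $\nu\in\{0,1,2\}$ let $c_k^{(\nu)}:=E_{2k+\nu}\!\left(\frac{x+1}{2}\right)$ for $k\ge 0$, where $E_m(\cdot)$ is the $m$th Euler polynomial, and let $\big(q_n^{(\nu)}(y;x)\big)_{n\geq 0}$ be the sequence of monic polynomials ($q_n^{(\nu)}$ of degree $n$ in $y$, with coefficients in $\mathbb{Q}(x)$) orthogonal in $y$ with respect to the sequence $(c_k^{(\nu)})_{k\ge0}$, that is, for all $n\ge 1$, $$y^{r}q_{n}^{(\nu)}(y;x)\Big|_{y^k=c_k^{(\nu)}}=0\qquad (0\leq r\leq n-1).$$ Then $q_{0}^{(\nu)}(y;x)=1$, $q_{1}^{(\nu)}(y;x)=y+\sigma_{0}^{(\nu)}$, and for $n\geq 1$, $$q_{n+1}^{(\nu)}(y;x)=(y+\sigma_{n}^{(\nu)})\,q_{n}^{(\nu)}(y;x)+\tau_{n}^{(\nu)}\,q_{n-1}^{(\nu)}(y;x),$$ where for $\nu=0,1,2$, $$\sigma_{n}^{(\nu)}=(2n+1)\left(n+\tfrac{\nu}{2}\right)-\frac{x^{2}-1}{4}\quad(n\ge0),\qquad \tau_{n}^{(\nu)}=\frac{n^{2}}{4}\left(x^{2}-(2n+\nu-1)^{2}\right)\quad(n\ge1).$$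
   Context: The Euler polynomials are defined by $\frac{2e^{xt}}{e^t+1}=\sum_{n\ge 0}E_n(x)\frac{t^n}{n!}$. For a polynomial $P(y)=\sum_j p_j y^j$ and a sequence $(a_k)_{k\ge0}$, the evaluation $P(y)\big|_{y^k=a_k}$ means $\sum_j p_j a_j$, i.e. one expands in powers of $y$ and replaces each $y^k$ by $a_k$, including $k=0$ (the constant term $p_0$ is replaced by $p_0a_0$). *)

(* Defs.v *)
From mathcomp Require Import all_boot all_order all_algebra.

Set Implicit Arguments.
Unset Strict Implicit.
Unset Printing Implicit Defensive.

Import GRing.Theory.
Local Open Scope ring_scope.

Section FormalPowerSeries.

Variable R : comUnitRingType.

(* The formal power series [\sum_n f n * t^n]. *)
Definition fps := nat -> R.

Definition fps_mul (f g : fps) : fps :=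
  fun n => \sum_(i < n.+1) f i * g (n - i)%N.

(* The first [n.+1] coefficients of [1 / f], meaningful when [f 0] is a unit:
   the coefficient [g n] solves [\sum_(i <= n) f i * g (n - i) = (n == 0)]. *)
Fixpoint fps_inv_coefs (f : fps) (n : nat) : seq R :=
  if n is m.+1 then
    let s := fps_inv_coefs f m in
    rcons s (- (f 0%N)^-1 * \sum_(i < n) f i.+1 * s`_(m - i))
  else [:: (f 0%N)^-1].

Definition fps_inv (f : fps) : fps := fun n => (fps_inv_coefs f n)`_n.

Definition fps_div (f g : fps) : fps := fps_mul f (fps_inv g).

Lemma size_fps_inv_coefs f n : size (fps_inv_coefs f n) = n.+1.
Proof. by elim: n => //= n IHn; rewrite size_rcons IHn. Qed.

Lemma nth_fps_inv_coefs f n k :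
  (k <= n)%N -> (fps_inv_coefs f n)`_k = fps_inv f k.
Proof.
elim: n => [|n IHn]; first by rewrite leqn0 => /eqP->.
rewrite leq_eqVlt => /predU1P[-> //|lt_kn].
by rewrite /= nth_rcons size_fps_inv_coefs lt_kn IHn.
Qed.

Lemma fps_mulV f :
  f 0%N \is a GRing.unit -> forall n, fps_mul f (fps_inv f) n = (n == 0%N)%:R.
Proof.
move=> Uf [|n]; first by rewrite /fps_mul big_ord1 /fps_inv /= mulrV.
rewrite /fps_mul big_ord_recl subn0 {1}/fps_inv /= nth_rcons size_fps_inv_coefs.
rewrite ltnn eqxx mulrA mulrN mulrV // mulN1r; apply/eqP.
rewrite addrC subr_eq0; apply/eqP; apply: eq_bigr => i _.
by rewrite nth_fps_inv_coefs ?leq_subr // subSS.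
Qed.

Lemma fps_mulC f g : fps_mul f g =1 fps_mul g f.
Proof.
move=> n; rewrite /fps_mul (reindex_inj rev_ord_inj) /=.
by apply: eq_bigr => i _; rewrite subSS subKn 1?mulrC // -ltnS.
Qed.

Lemma eq_fps_mul f f' g g' :
  f =1 f' -> g =1 g' -> fps_mul f g =1 fps_mul f' g'.
Proof. by move=> ff' gg' n; apply: eq_bigr => i _; rewrite ff' gg'. Qed.

Lemma coef_fps_mul f g n N : (n < N)%N ->
  fps_mul f g n = ((\poly_(i < N) f i) * (\poly_(i < N) g i))`_n.
Proof.
move=> ltnN; rewrite coefM; apply: eq_bigr => i _; rewrite !coef_poly.
by rewrite (leq_ltn_trans _ ltnN) ?(leq_ltn_trans _ ltnN) ?leq_subr // -ltnS.
Qed.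

Lemma fps_mulA f g h :
  fps_mul f (fps_mul g h) =1 fps_mul (fps_mul f g) h.
Proof.
move=> n; pose P (u : fps) := \poly_(i < n.+1) u i.
transitivity ((P f * (P g * P h))`_n).
  rewrite coefM; apply: eq_bigr => i _.
  by rewrite coef_poly ltn_ord (@coef_fps_mul _ _ _ n.+1) // ltnS leq_subr.
rewrite mulrA coefM; apply: eq_bigr => i _.
by rewrite (@coef_fps_mul _ _ _ n.+1) // [(P h)`_ _]coef_poly ltnS leq_subr.
Qed.

Lemma fps_mul1 f : fps_mul f (fun n => (n == 0%N)%:R) =1 f.
Proof.
move=> n; rewrite fps_mulC /fps_mul big_ord_recl mul1r subn0 big1 ?addr0 //.
by move=> i _; rewrite mul0r.
Qed.

Lemma fps_mul_div f g :
  g 0%N \is a GRing.unit -> fps_mul g (fps_div f g) =1 f.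
Proof.
move=> Ug n; rewrite fps_mulC /fps_div -fps_mulA.
rewrite (eq_fps_mul (frefl f) (g' := fun n => (n == 0%N)%:R)) ?fps_mul1 // => k.
by rewrite fps_mulC fps_mulV.
Qed.

End FormalPowerSeries.

(* The power series [exp (a t)] with coefficients in [Q[x]]. *)
Definition fps_exp (a : {poly rat}) : fps {poly rat} :=
  fun n => (n`!%:R : rat)^-1 *: a ^+ n.

Definition exp_add1 : fps {poly rat} :=
  fun n => fps_exp 1 n + (n == 0%N)%:R.

(* [n`!] times the coefficient of [t^n] in [2 exp (x t) / (exp t + 1)]. *)
Definition euler_poly (n : nat) : {poly rat} :=
  (n`!%:R : rat) *: fps_div (fun k => 2 * fps_exp 'X k) exp_add1 n.

Lemma euler_poly_egf n :
  fps_mul exp_add1 (fun k => (k`!%:R : rat)^-1 *: euler_poly k) n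
    = 2 * fps_exp 'X n.
Proof.
rewrite -[RHS](@fps_mul_div _ (fun k => 2 * fps_exp 'X k) exp_add1).
  apply: eq_fps_mul => // k; rewrite /euler_poly scalerA mulVf ?scale1r //.
  by rewrite Num.Theory.pnatr_eq0 -lt0n fact_gt0.
rewrite /exp_add1 /fps_exp fact0 invr1 scale1r expr0 -polyCD.
by rewrite poly_unitE coefC size_polyC.
Qed.

(* The field [Q(x)] and its indeterminate. *)
Notation Qx := {fraction {poly rat}}.
Definition varx : Qx := tofrac 'X.

(* [P(y)] evaluated under the substitution [y^k = a k]. *)
Definition umbral_eval (F : fieldType) (a : nat -> F) (P : {poly F}) : F :=
  \sum_(j < size P) P`_j * a j.

Definition monic_orthogonal (F : fieldType) (a : nat -> F)
    (q : nat -> {poly F}) : Prop :=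
  (forall n, size (q n) = n.+1 /\ q n \is monic) /\
  (forall n r, (1 <= n)%N -> (r <= n - 1)%N ->
     umbral_eval a ('X^r * q n) = 0).

(* The moments [c_k^(nu)], that is [E_(2k+nu) ((x+1)/2)]. *)
Definition euler_moment (nu k : nat) : Qx :=
  tofrac (euler_poly (2 * k + nu) \Po ((2 : rat)^-1 *: ('X + 1))).

Definition sigma (nu n : nat) : Qx :=
  (2 * n + 1)%:R * (n%:R + nu%:R / 2) - (varx ^+ 2 - 1) / 4.

Definition tau (nu n : nat) : Qx :=
  n%:R ^+ 2 / 4 * (varx ^+ 2 - (2 * n%:R + nu%:R - 1) ^+ 2).

(* Main.v *)
Require Import Defs.
From HB Require Import structures.
From mathcomp Require Import all_boot all_order all_algebra.
From mathcomp Require Import ring.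
Import GRing.Theory.
Local Open Scope ring_scope.

(** Let M be the linear functional on polynomials in z that sends z^m to
    E_m(c), where c = (x+1)/2.  The moments of the theorem are those of the
    functional L : f |-> M(z^nu f(z^2)).  The generating function of the Euler
    polynomials says exactly that
      M(g(z+1) + g(z)) = 2 g(c)   for every polynomial g,
    and this identity is the only fact about Euler polynomials that is used
    ([euler_poly_rec], [euler_half_succ_functional], [umbral_eval_shift]).

    The monic polynomials of the theorem are continuous dual Hahn polynomials
    with parameters a = nu/2, b = (1-x)/2 = 1 - c and c.  Their recurrence
    coefficients, in terms of the parameters, are
      sigma_n = (2n+1)(n+a) + bc,
      tau_n = - n^2 (n+a+b-1)(n+a+c-1).
    Their orthogonality is checked against the test polynomials
      psi_j(y) = prod_(i < j) ((c+i)^2 - y).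

    The values of L on the psi_j come from M.  Take
      g(z) = psi_j(z^2) (z-(c+j)) (z-b) E_nu(z).
    Shifting z by 1 merely shifts the window of linear factors, so g(z+1) is
    psi_j(z^2) (z+(c+j)) (z+b) E_nu(z+1) ([psi_sqr_shift]); moreover
    g(c) = 0.  For nu <= 2 the polynomial E_nu satisfies both
      E_nu(z+1) + E_nu(z) = 2 z^nu   and   E_nu(z+1) - E_nu(z) = nu z^(nu-1),
    the second of which fails for nu = 3.  These turn M(g(z+1) + g(z)) = 0 into
      L(psi_(j+1)) = (a+c+j)(j+1) L(psi_j)   ([moment_psi]).

    Let Q_n be defined by the recurrence of the theorem.  Since
    y psi_j = (c+j)^2 psi_j - psi_(j+1), the numbers L(psi_j Q_n) satisfy a
    recurrence in n and j, and induction on n gives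
      L(psi_j Q_n) = (-1)^n (a+b)_n j(j-1)...(j-n+1) L(psi_j)
    with (a+b)_n the rising factorial ([umbral_psi_three_term]).  The falling
    factorial vanishes for j < n, so Q is orthogonal; for j = n the value is
    nonzero, so L is nondegenerate and Q is the only monic orthogonal
    sequence ([monic_orthogonal_unique]). *)

(** * Linear functionals given by their moments *)

Section UmbralEval.

Context {F : fieldType}.
Implicit Types (a : nat -> F) (P Q : {poly F}).

(** A bound on the degree that does not depend on the polynomial makes the
    additivity of [umbral_eval] visible. *)
Lemma umbral_eval_widen a P N : (size P <= N)%N ->
  umbral_eval a P = \sum_(j < N) P`_j * a j.
Proof.
move=> leN; rewrite /umbral_eval (big_ord_widen N (fun j => P`_j * a j)) //.
rewrite [RHS](bigID (fun j : 'I_N => (j < size P)%N)) /= [X in _ + X]big1 ?addr0 //.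
by move=> j; rewrite -leqNgt => ?; rewrite nth_default ?mul0r.
Qed.

Lemma umbral_eval_is_linear a : scalar (umbral_eval a).
Proof.
move=> k P Q; pose N := maxn (size P) (size Q).
have leP : (size P <= N)%N by rewrite leq_maxl.
have leQ : (size Q <= N)%N by rewrite leq_maxr.
have lePQ : (size (k *: P + Q)%R <= N)%N.
  by rewrite (leq_trans (size_polyD _ _)) // geq_max leQ (leq_trans (size_scale_leq _ _)).
rewrite !(umbral_eval_widen _ _ N) // mulr_sumr -big_split /=.
by apply: eq_bigr => j _; rewrite coefD coefZ mulrDl mulrA.
Qed.

HB.instance Definition _ a :=
  GRing.isLinear.Build F {poly F} F _ (umbral_eval a) (umbral_eval_is_linear a).

Lemma umbral_evalXn a k : umbral_eval a 'X^k = a k.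
Proof.
rewrite (umbral_eval_widen _ _ k.+1) ?size_polyXn // big_ord_recr /= coefXn eqxx mul1r.
by rewrite big1 ?add0r // => j _; rewrite coefXn (ltn_eqF (ltn_ord j)) mul0r.
Qed.

(** The scaling of the codomain as a product, which rewriting with [linearZ]
    would leave as a scaling of the regular module. *)
Lemma umbral_evalZ a k P : umbral_eval a (k *: P) = k * umbral_eval a P.
Proof. exact: linearZ. Qed.

Definition orthogonal_to a n Q := forall f : {poly F}, (size f <= n)%N ->
  umbral_eval a (f * Q) = 0.

Lemma orthogonal_to_monomials a n Q :
  (forall r, (r < n)%N -> umbral_eval a ('X^r * Q) = 0) -> orthogonal_to a n Q.
Proof.
move=> oQ f szf; rewrite -(coefK f) poly_def mulr_suml linear_sum /= big1 // => i _.
by rewrite -scalerAl umbral_evalZ oQ ?mulr0 // (leq_trans (ltn_ord i)).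
Qed.

(** A polynomial of degree n - 1 is a multiple of [psi (n - 1)] plus a polynomial
    of lower degree, so induction on n applies. *)
Lemma orthogonal_to_graded a n Q (psi : nat -> {poly F}) :
  (forall j, size (psi j) = j.+1) ->
  (forall j, (j < n)%N -> umbral_eval a (psi j * Q) = 0) -> orthogonal_to a n Q.
Proof.
move=> szpsi oQ; elim: n oQ => [|n IHn] oQ f.
  by rewrite leqn0 size_poly_eq0 => /eqP ->; rewrite mul0r linear0.
move=> szf; pose k := f`_n / (psi n)`_n.
have lcn : (psi n)`_n != 0.
  by have:= lead_coef_eq0 (psi n); rewrite /lead_coef szpsi -size_poly_eq0 szpsi /= => ->.
have szd : (size (f - k *: psi n)%R <= n)%N.
  apply/leq_sizeP => j; rewrite leq_eqVlt => /predU1P[<-|ltnj].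
    by rewrite coefB coefZ divfK ?subrr.
  rewrite coefB coefZ [f`_j]nth_default ?(leq_trans szf) //.
  by rewrite [(psi n)`_j]nth_default ?szpsi // mulr0 subrr.
rewrite -[f](subrK (k *: psi n)) mulrDl linearD /= IHn //; last first.
  by move=> j ltjn; rewrite oQ // ltnS ltnW.
by rewrite -scalerAl umbral_evalZ oQ // mulr0 addr0.
Qed.

(** If [p n] and [q n] differ, their difference d has degree m < n, hence it is
    orthogonal to [p m].  Any f of degree at most m is a multiple of d plus a
    polynomial of degree less than m, so [p m] is orthogonal to f, which
    contradicts nondegeneracy. *)
Lemma monic_orthogonal_unique a (p q : nat -> {poly F}) :
  monic_orthogonal a p -> monic_orthogonal a q ->
  (forall n, exists2 f : {poly F}, (size f <= n.+1)%N & umbral_eval a (f * p n) != 0) ->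
  p =1 q.
Proof.
move=> [mp op] [mq oq] nzp n.
have o_of r : monic_orthogonal a r -> forall m, orthogonal_to a m (r m).
  case=> _ orr [|m] f; first by rewrite leqn0 size_poly_eq0 => /eqP ->; rewrite mul0r linear0.
  by apply: orthogonal_to_monomials => s lts; rewrite orr // subn1.
have op' := o_of _ (conj mp op); have oq' := o_of _ (conj mq oq).
apply/eqP; rewrite -subr_eq0; set d := p n - q n; apply/negPn/negP => nzd.
have szd : (size d <= n)%N.
  have [[szp /monicP lp] [szq /monicP lq]] := (mp n, mq n).
  apply/leq_sizeP => j; rewrite leq_eqVlt => /predU1P[<-|ltnj].
    by move: lp lq; rewrite /lead_coef szp szq /= coefB => -> ->; rewrite subrr.
  by rewrite coefB !nth_default ?szp ?szq ?subrr.
have od : orthogonal_to a n d.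
  by move=> f szf; rewrite mulrBr linearB /= op' // oq' // subr0.
pose m := (size d).-1.
have szdm : size d = m.+1 by rewrite prednK // lt0n size_poly_eq0.
have [f szf /negP[]] := nzp m; apply/eqP.
pose k := f`_m / d`_m.
have lcd : d`_m != 0 by rewrite -/(lead_coef d) lead_coef_eq0.
rewrite -[f](subrK (k *: d)) mulrDl linearD /= op' ?add0r; last first.
  apply/leq_sizeP => j; rewrite leq_eqVlt => /predU1P[<-|ltmj].
    by rewrite coefB coefZ divfK ?subrr.
  by rewrite coefB coefZ !nth_default ?szdm ?mulr0 ?subrr // (leq_trans szf).
rewrite -scalerAl umbral_evalZ mulrC [d * _]mulrC od ?mul0r //.
by case: (mp m) => ->; rewrite -szdm.
Qed.

End UmbralEval.

(** * Three-term recurrences and continuous dual Hahn polynomials *)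

Fixpoint three_term {F : fieldType} (s t : nat -> F) (n : nat) : {poly F} :=
  match n with
  | 0 => 1
  | m.+1 => if m is k.+1
            then ('X + (s m)%:P) * three_term s t m + (t m)%:P * three_term s t k
            else 'X + (s 0%N)%:P
  end.

Lemma three_termS {F : fieldType} (s t : nat -> F) n :
  three_term s t n.+2 = ('X + (s n.+1)%:P) * three_term s t n.+1
                        + (t n.+1)%:P * three_term s t n.
Proof. by []. Qed.

Lemma eq_three_term {F : fieldType} (s s' t t' : nat -> F) :
  s =1 s' -> t =1 t' -> three_term s t =1 three_term s' t'.
Proof.
move=> ss' tt' n; suff /(_ n)[]: forall n,
  three_term s t n = three_term s' t' n /\ three_term s t n.+1 = three_term s' t' n.+1 by [].
elim=> [|m [IH0 IH1]]; first by rewrite /= ss'.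
by rewrite !three_termS IH0 IH1 ss' tt'.
Qed.

Lemma three_term_monic {F : fieldType} (s t : nat -> F) n :
  size (three_term s t n) = n.+1 /\ three_term s t n \is monic.
Proof.
suff /(_ n)[]: forall n, (size (three_term s t n) = n.+1 /\ three_term s t n \is monic) /\
     (size (three_term s t n.+1) = n.+2 /\ three_term s t n.+1 \is monic) by [].
elim=> [|m [[szm mm] [szm1 mm1]]].
  by rewrite /= size_poly1 monic1 size_XaddC monicXaddC.
split=> //; rewrite three_termS.
have szX : size (('X + (s m.+1)%:P) * three_term s t m.+1) = m.+3.
  by rewrite size_monicM ?monicXaddC ?monic_neq0 // size_XaddC szm1.
have lt : (size ((t m.+1)%:P * three_term s t m)%R <
           size (('X + (s m.+1)%:P) * three_term s t m.+1)%R)%N.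
  by rewrite szX mul_polyC (leq_ltn_trans (size_scale_leq _ _)) // szm.
by rewrite size_polyDl // szX monicE lead_coefDl // -monicE monicMl ?monicXaddC.
Qed.

Section Orthogonality.

Context {F : fieldType}.
Variables a c : F.

Definition rising (u : F) n : F := \prod_(i < n) (u + i%:R).

Lemma risingS u n : rising u n.+1 = rising u n * (u + n%:R).
Proof. by rewrite /rising big_ord_recr. Qed.

(** The squares (c+i)^2 make [psi n] at y = z^2 the product of the rising
    factorials of c+z and c-z, to which a shift of z by 1 applies well. *)
Definition psi n : {poly F} := \prod_(i < n) ((c%:P + i%:R) ^+ 2 - 'X).

Lemma psiS n : psi n.+1 = psi n * ((c%:P + n%:R) ^+ 2 - 'X).
Proof. by rewrite /psi big_ord_recr. Qed.

Lemma size_psi n : size (psi n) = n.+1.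
Proof.
elim: n => [|n IHn]; first by rewrite /psi big_ord0 size_poly1.
have -> : psi n.+1 = - (psi n * ('X - ((c + n%:R) ^+ 2)%:P)).
  by rewrite psiS polyC_exp polyCD rmorph_nat; ring.
rewrite size_polyN size_Mmonic ?monicXsubC -?size_poly_eq0 ?IHn //.
by rewrite size_XsubC addn2.
Qed.

(** The recurrence coefficients of the continuous dual Hahn polynomials with
    parameters a, b = 1 - c and c, in the variable y = z^2; the general sigma_n is
    (n+a+b)(n+a+c) + n(n+b+c-1) - a^2. *)
Definition hahn_sigma n : F := (2 * n + 1)%:R * (n%:R + a) + (1 - c) * c.
Definition hahn_tau n : F := - (n%:R ^+ 2) * (n%:R + a - c) * (n%:R + a + c - 1).
Local Notation Q := (three_term hahn_sigma hahn_tau).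

Variable mu : nat -> F.
Hypothesis mu_psi : forall j,
  umbral_eval mu (psi j.+1) = (a + c + j%:R) * j.+1%:R * umbral_eval mu (psi j).

(** With the subtraction taken in F the identity needs no bound on n: both sides
    vanish for j <= n. *)
Lemma ffactS_ring j n : (j ^_ n.+1)%:R = (j%:R - n%:R) * (j ^_ n)%:R :> F.
Proof.
rewrite ffactnSr natrM mulrC; case: (leqP n j) => [lenj|ltjn].
  by rewrite natrB.
by rewrite ffact_small // !mulr0.
Qed.

(** Multiplication by y raises the index of the test polynomial, because
    y psi_j = (c+j)^2 psi_j - psi_(j+1). *)
Lemma umbral_psi_mulX j P (s : F) :
  umbral_eval mu (psi j * (('X + s%:P) * P)) =
  ((c + j%:R) ^+ 2 + s) * umbral_eval mu (psi j * P) - umbral_eval mu (psi j.+1 * P).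
Proof.
rewrite -umbral_evalZ -linearB -mul_polyC psiS; congr umbral_eval.
by rewrite !(polyCD, polyC_exp) rmorph_nat; ring.
Qed.

(** Once the common factors are removed, the inductive step is a polynomial
    identity in j and n.  The closed form is a multiple of the falling factorial
    of j, and this is the whole reason for orthogonality. *)
Lemma umbral_psi_three_term n j :
  umbral_eval mu (psi j * Q n) =
  (-1) ^+ n * rising (a + 1 - c) n * (j ^_ n)%:R * umbral_eval mu (psi j).
Proof.
suff /(_ n)[]: forall n, (forall j, umbral_eval mu (psi j * Q n) =
    (-1) ^+ n * rising (a + 1 - c) n * (j ^_ n)%:R * umbral_eval mu (psi j)) /\
  (forall j, umbral_eval mu (psi j * Q n.+1) =
    (-1) ^+ n.+1 * rising (a + 1 - c) n.+1 * (j ^_ n.+1)%:R * umbral_eval mu (psi j)) by [].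
elim=> [|m [IH0 IH1]].
  split=> k; first by rewrite mulr1 expr0 /rising big_ord0 ffactn0 !mul1r.
  rewrite -[Q 1]mulr1 umbral_psi_mulX !mulr1 mu_psi risingS /rising big_ord0 ffactn1.
  by rewrite /hahn_sigma; ring.
split=> // k; rewrite three_termS mulrDr linearD /= umbral_psi_mulX !IH1.
rewrite [psi k * (_%:P * _)]mulrCA mul_polyC umbral_evalZ IH0 mu_psi ffactSS natrM !risingS !ffactS_ring.
by rewrite /hahn_sigma /hahn_tau !exprS; ring.
Qed.

Lemma three_term_monic_orthogonal : monic_orthogonal mu Q.
Proof.
split=> [|n r n_gt0 ler]; first exact: three_term_monic.
apply: (@orthogonal_to_graded _ mu n _ psi); first exact: size_psi.
  by move=> j ltjn; rewrite umbral_psi_three_term ffact_small // mulr0 mul0r.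
by rewrite size_polyXn; move: n_gt0 ler; case: n => // n; rewrite subn1.
Qed.

Hypothesis Dab : forall i, a + 1 - c + i%:R != 0.
Hypothesis Dac : forall i, a + c + i%:R != 0.
Hypothesis char0 : forall i, i.+1%:R != 0 :> F.
Hypothesis mu0 : mu 0%N != 0.

Lemma umbral_psi_neq0 j : umbral_eval mu (psi j) != 0.
Proof.
elim: j => [|j IHj]; last by rewrite mu_psi !mulf_neq0.
by rewrite /psi big_ord0 -(expr0 'X) umbral_evalXn.
Qed.

Lemma monic_orthogonal_three_term q : monic_orthogonal mu q -> q =1 Q.
Proof.
move=> oq n; apply/esym; move: n.
apply: monic_orthogonal_unique three_term_monic_orthogonal oq _ => n.
exists (psi n); first by rewrite size_psi.
rewrite umbral_psi_three_term ffactnn !mulf_neq0 ?expf_neq0 ?oppr_eq0 ?oner_eq0 //.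
- by apply/prodf_neq0 => i _; apply: Dab.
- by rewrite -(prednK (fact_gt0 n)); apply: char0.
- exact: umbral_psi_neq0.
Qed.

End Orthogonality.

(** * The functional of the Euler polynomials *)

Section EulerFunctional.

Context {F : fieldType}.
Variables (a c : F) (nu : nat) (h : {poly F}) (e : nat -> F).

(* The power of z of the identity M(g(z+1) + g(z)) = 2 g(c). *)
Hypothesis e_functional : forall n,
  umbral_eval e (('X + 1) ^+ n + 'X^n) = 2 * c ^+ n.
Hypothesis two_neq0 : 2 != 0 :> F.

Lemma umbral_eval_shift g : umbral_eval e (g \Po ('X + 1) + g) = 2 * g.[c].
Proof.
rewrite horner_coef mulr_sumr -[in LHS](coefK g) poly_def.
rewrite [X in umbral_eval e (X + _)]linear_sum -big_split linear_sum /=.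
apply: eq_bigr => i _; rewrite comp_polyZ comp_Xn_poly -scalerDr umbral_evalZ.
by rewrite e_functional mulrCA.
Qed.

Lemma umbral_eval_sqr f :
  umbral_eval (fun k => e (2 * k + nu)%N) f = umbral_eval e ('X^nu * (f \Po 'X^2)).
Proof.
rewrite -[in RHS](coefK f) poly_def (linear_sum (comp_poly 'X^2)) mulr_sumr linear_sum.
apply: eq_bigr => i _; rewrite /= comp_polyZ comp_Xn_poly -scalerAr umbral_evalZ.
by rewrite -exprM -exprD umbral_evalXn addnC.
Qed.

Definition psi_sqr j := psi c j \Po 'X^2.

Lemma psi_sqrS j : psi_sqr j.+1 = psi_sqr j * ((c%:P + j%:R) ^+ 2 - 'X^2).
Proof.
rewrite /psi_sqr psiS comp_polyM comp_polyB comp_polyX rmorphXn /=.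
by rewrite comp_polyD comp_polyC rmorph_nat.
Qed.

(** Both sides equal, up to sign, the product of the z+c+i with i <= j, of the
    z-c-i with i < j, and of z+1-c: the shift drops one factor of each rising
    factorial and creates one at the other end. *)
Lemma psi_sqr_shift j :
  (psi_sqr j \Po ('X + 1)) * (('X + 1 - (c%:P + j%:R)) * ('X + 1 - (1 - c%:P)))
  = psi_sqr j * (('X + (c%:P + j%:R)) * ('X + (1 - c%:P))).
Proof.
elim: j => [|j IHj].
  by rewrite /psi_sqr /psi big_ord0 !comp_polyC; ring.
rewrite psi_sqrS comp_polyM.
have -> : ((c%:P + j%:R) ^+ 2 - 'X^2) \Po ('X + 1)
   = - (('X + 1 - (c%:P + j%:R)) * ('X + 1 + (c%:P + j%:R))).
  rewrite comp_polyB comp_Xn_poly rmorphXn /= comp_polyD comp_polyC rmorph_nat. ring.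
transitivity (- ('X - (c%:P + j%:R)) * ('X + 1 + (c%:P + j%:R)) * (
  (psi_sqr j \Po ('X + 1)) * (('X + 1 - (c%:P + j%:R)) * ('X + 1 - (1 - c%:P))))); first by ring.
by rewrite IHj; ring.
Qed.

(* The two properties of h = E_nu, with a = nu / 2. *)
Hypothesis h_sum : (h \Po ('X + 1)) + h = 2 * 'X^nu.
Hypothesis h_diff : 'X * ((h \Po ('X + 1)) - h) = 2 * a%:P * 'X^nu.

Lemma moment0 : e nu = h.[c].
Proof.
apply: (mulfI two_neq0); rewrite -umbral_eval_shift h_sum.
by rewrite -(rmorph_nat polyC) mul_polyC umbral_evalZ umbral_evalXn.
Qed.

(** The polynomial g vanishes at c: its factor z - (c+j) does when j = 0, and
    its factor psi_j(z^2) does when j > 0.  Hence M(g(z+1) + g(z)) = 0.  The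
    factors (z+c+j)(z+b) and (z-c-j)(z-b) have the same even part and opposite
    odd parts, which is why h enters through its sum and its difference with
    its shift. *)
Lemma moment_psi j :
  let mu k := e (2 * k + nu)%N in
  umbral_eval mu (psi c j.+1) = (a + c + j%:R) * j.+1%:R * umbral_eval mu (psi c j).
Proof.
move=> mu; rewrite !umbral_eval_sqr -/(psi_sqr j) -/(psi_sqr j.+1).
pose g := psi_sqr j * (('X - (c%:P + j%:R)) * ('X - (1 - c%:P)) * h).
have gc : g.[c] = 0.
  rewrite /g /psi_sqr !hornerM horner_comp hornerXn !hornerE.
  case: (j) => [|i].
    by rewrite /= horner0 addr0 subrr mulr0 !mul0r.
  by rewrite /= /psi big_ord_recl /= addr0 !hornerE subrr !mul0r.
have gsum : (g \Po ('X + 1)) + g =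
   2 *: ((a + c + j%:R) * j.+1%:R *: ('X^nu * psi_sqr j) - 'X^nu * psi_sqr j.+1).
  transitivity (psi_sqr j * (
     ('X^2 + (c%:P + j%:R) * (1 - c%:P)) * ((h \Po ('X + 1)) + h)
     + j.+1%:R * ('X * ((h \Po ('X + 1)) - h)))).
    rewrite /g !comp_polyM !comp_polyB !comp_polyX comp_polyD !comp_polyC rmorph_nat.
    transitivity ((psi_sqr j \Po ('X + 1)) * (('X + 1 - (c%:P + j%:R)) * ('X + 1 - (1 - c%:P)))
       * (h \Po ('X + 1)) + g); first by rewrite /g; ring.
    by rewrite psi_sqr_shift /g; ring.
  rewrite h_sum h_diff psi_sqrS -!mul_polyC !(polyCM, polyCD) !rmorph_nat.
  ring.
have := umbral_eval_shift g; rewrite gc mulr0 gsum umbral_evalZ => /eqP.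
rewrite mulf_eq0 (negPf two_neq0) /= linearB /= umbral_evalZ subr_eq0.
by move=> /eqP ->.
Qed.

End EulerFunctional.

(** * The case of low degree *)

Section LowDegree.

Context {F : fieldType}.
Variables (x : F) (nu : nat) (e : nat -> F).
Hypothesis hnu : nu \in [:: 0; 1; 2]%N.
Hypothesis char0 : forall n, n.+1%:R != 0 :> F.
Hypothesis xDn_neq0 : forall n, x + n%:R != 0.
Hypothesis nBx_neq0 : forall n, n%:R - x != 0.
Let c : F := (x + 1) / 2.
Hypothesis e_functional : forall n,
  umbral_eval e (('X + 1) ^+ n + 'X^n) = 2 * c ^+ n.

(** The Euler polynomial E_nu for nu <= 2. *)
Definition euler_low : {poly F} :=
  match nu with 0 => 1 | 1 => 'X - (2^-1)%:P | _ => 'X * ('X - 1) end.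

Let two_neq0 : 2 != 0 :> F := char0 1.
Let half2 : 2 * (2^-1)%:P = 1 :> {poly F}.
Proof. by rewrite -(rmorph_nat polyC) -polyCM mulfV. Qed.

Lemma euler_low_sum : (euler_low \Po ('X + 1)) + euler_low = 2 * 'X^nu.
Proof.
move: hnu; rewrite /euler_low !inE => /or3P[] /eqP ->.
- by rewrite comp_polyC; ring.
- rewrite comp_polyB comp_polyX comp_polyC.
  transitivity (2 * 'X + (1 - 2 * (2^-1)%:P) : {poly F}); first by ring.
  by rewrite half2; ring.
- by rewrite comp_polyM comp_polyB !comp_polyX comp_polyC; ring.
Qed.

Lemma euler_low_diff :
  'X * ((euler_low \Po ('X + 1)) - euler_low) = 2 * (nu%:R / 2)%:P * 'X^nu.
Proof.
rewrite polyCM rmorph_nat mulrCA half2 mulr1.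
move: hnu; rewrite /euler_low !inE => /or3P[] /eqP ->.
- by rewrite comp_polyC; ring.
- by rewrite comp_polyB comp_polyX comp_polyC; ring.
- by rewrite comp_polyM comp_polyB !comp_polyX comp_polyC; ring.
Qed.

(** This is the zeroth moment: 1, x / 2 and (x^2 - 1) / 4 respectively. *)
Lemma euler_low_neq0 : euler_low.[c] != 0.
Proof.
move: hnu; rewrite /c /euler_low !inE => /or3P[] /eqP ->; rewrite !hornerE ?oner_eq0 //.
- have -> : (x + 1) / 2 - 2^-1 = (x + 0%:R) / 2 by field.
  by rewrite mulf_neq0 ?invr_eq0.
- have -> : (x + 1) / 2 * ((x + 1) / 2 - 1) = - ((x + 1%:R) / 2 * ((1%:R - x) / 2)) by field.
  by rewrite oppr_eq0 !mulf_neq0 ?invr_eq0.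
Qed.

(** Stated over an abstract field, of characteristic zero, with x not an integer:
    every parameter a+b+i and a+c+i is then nonzero. *)
Lemma euler_moment_recurrence (q : nat -> {poly F}) :
  monic_orthogonal (fun k => e (2 * k + nu)%N) q ->
  q =1 three_term
    (fun n => (2 * n + 1)%:R * (n%:R + nu%:R / 2) - (x ^+ 2 - 1) / 4)
    (fun n => n%:R ^+ 2 / 4 * (x ^+ 2 - (2 * n%:R + nu%:R - 1) ^+ 2)).
Proof.
have four_neq0 : 4 != 0 :> F := char0 3.
move=> hq; set s := fun n : nat => _; set t := fun n : nat => _.
pose a : F := nu%:R / 2.
have sE n : hahn_sigma a c n = s n by rewrite /hahn_sigma /s /a /c; field; rewrite four_neq0.
have tE n : hahn_tau a c n = t n by rewrite /hahn_tau /t /a /c; field; rewrite four_neq0.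
move=> n; rewrite -(eq_three_term _ _ _ _ sE tE); move: n.
apply: monic_orthogonal_three_term hq => //.
- by move=> j; apply: (moment_psi a c nu euler_low) => //;
    [apply: euler_low_sum | apply: euler_low_diff].
- move=> i; have -> : a + 1 - c + i%:R = ((nu + 2 * i + 1)%:R - x) / 2.
    by rewrite /a /c; field.
  by rewrite mulf_neq0 ?invr_eq0.
- move=> i; have -> : a + c + i%:R = (x + (nu + 2 * i + 1)%:R) / 2.
    by rewrite /a /c; field.
  by rewrite mulf_neq0 ?invr_eq0.
- rewrite muln0 add0n (moment0 c nu euler_low) ?euler_low_neq0 //.
  exact: euler_low_sum.
Qed.

End LowDegree.

(** * Euler polynomials over the field of rational functions *)

(** The product of the generating function by exp t + 1, coefficientwise. *)
Lemma euler_poly_rec n :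
  (\sum_(i < n.+1) euler_poly i *+ 'C(n, i)) + euler_poly n = 2 * 'X^n.
Proof.
have factU k : k`!%:R != 0 :> rat by rewrite Num.Theory.pnatr_eq0 -lt0n fact_gt0.
have := euler_poly_egf n; rewrite fps_mulC => /(congr1 (fun p => (n`!%:R : rat) *: p)).
rewrite /fps_exp scalerAr scalerA divff // scale1r => <-.
rewrite /fps_mul /exp_add1 /fps_exp.
under [in RHS]eq_bigr => i _ do rewrite mulrDr expr1n.
rewrite big_split scalerDr /=; congr (_ + _).
  rewrite scaler_sumr; apply: eq_bigr => i _; rewrite -scalerAr mulr1 2!scalerA.
  rewrite -scaler_nat; congr (_ *: _).
  have lein : (i <= n)%N by rewrite -ltnS.
  by rewrite -(bin_fact lein) !natrM; field; rewrite !factU.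
rewrite big_ord_recr /= subnn eqxx mulr1 big1 ?add0r.
  by rewrite scalerA divff // scale1r.
by move=> i _; rewrite subn_eq0 leqNgt ltn_ord mulr0.
Qed.

Definition half_succ : {poly rat} := (2 : rat)^-1 *: ('X + 1).

Definition euler_half_succ (m : nat) : Qx := tofrac (euler_poly m \Po half_succ).

Lemma euler_half_succ_functional n :
  umbral_eval euler_half_succ (('X + 1) ^+ n + 'X^n) = 2 * tofrac half_succ ^+ n.
Proof.
rewrite exprDn linearD linear_sum /= umbral_evalXn.
rewrite -rmorphXn -(rmorph_nat (@tofrac _)) -rmorphM -(comp_Xn_poly half_succ).
have -> : 2 * ('X^n \Po half_succ) = (2 * 'X^n) \Po half_succ.
  by rewrite comp_polyM -(rmorph_nat polyC) comp_polyC.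
rewrite -euler_poly_rec comp_polyD rmorphD; congr (_ + _).
rewrite (linear_sum (comp_poly half_succ)) rmorph_sum (reindex_inj rev_ord_inj) /=.
apply: eq_bigr => i _; rewrite subSS expr1n mulr1 subKn -1?ltnS //.
rewrite linearMn /= umbral_evalXn raddfMn /= rmorphMn /=.
by rewrite bin_sub // -ltnS.
Qed.

Lemma natr_Qx_neq0 n : n.+1%:R != 0 :> Qx.
Proof.
by rewrite -(rmorph_nat (@tofrac _)) tofrac_eq0 -(rmorph_nat polyC) polyC_eq0 Num.Theory.pnatr_eq0.
Qed.

Lemma varxD_natr_neq0 n : varx + n%:R != 0.
Proof.
rewrite -(rmorph_nat (@tofrac _)) -rmorphD tofrac_eq0 -(rmorph_nat polyC).
by rewrite -size_poly_eq0 size_XaddC.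
Qed.

Lemma natrB_varx_neq0 n : n%:R - varx != 0.
Proof.
rewrite -(rmorph_nat (@tofrac _)) -rmorphB tofrac_eq0 -(rmorph_nat polyC).
by rewrite -opprB oppr_eq0 polyXsubC_eq0.
Qed.

Lemma tofrac_half_succ : tofrac half_succ = (varx + 1) / 2.
Proof.
have two_neq0 := natr_Qx_neq0 1.
apply: (mulIf two_neq0); rewrite divfK // mulrC -(rmorph_nat (@tofrac _)) -rmorphM.
by rewrite -(rmorph_nat polyC) mul_polyC scalerA divff // scale1r rmorphD rmorph1.
Qed.

Theorem theorem5p1 (nu : nat) (hnu : nu \in [:: 0; 1; 2]%N)
    (q : nat -> {poly Qx}) (hq : monic_orthogonal (euler_moment nu) q) :
  q 0%N = 1 /\
  q 1%N = 'X + (sigma nu 0)%:P /\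
  (forall n : nat, (1 <= n)%N ->
     q n.+1 = ('X + (sigma nu n)%:P) * q n + (tau nu n)%:P * q n.-1).
Proof.
have qE : q =1 three_term (sigma nu) (tau nu).
  apply: (euler_moment_recurrence varx nu euler_half_succ) hq.
  - exact: hnu.
  - exact: natr_Qx_neq0.
  - exact: varxD_natr_neq0.
  - exact: natrB_varx_neq0.
  - by move=> n; rewrite euler_half_succ_functional tofrac_half_succ.
split; first exact: qE.
split=> [|[//|n] _]; first exact: qE.
by rewrite !qE.
Qed.
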